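(* Let $n=2$, $T>0$, $N\in\mathbb N$, $h=1/(N+1)$, and let $\mathcal M=\{h,2h,\dots,Nh\}^2$. Let $G_0\subset G=(0,1)^2$ be such that $i\ne j$ for every point $(x_i,x_j)=(ih,jh)\in G_0\cap\mathcal M$. Define $\psi$ on $\mathcal M$ by $\psi(x_i,x_j)=(-1)^i$ if $i=j$ and $\psi(x_i,x_j)=0$ if $i\ne j$. Then for every initial datum $y_0\in L^2_{\mathcal F_0}(\Omega;L^2_h(\mathcal M))$ and every control pair $(u,v)\in L^2_{\mathbb F}(0,T;L^2_h(G_0\cap\mathcal M))\times L^2_{\mathbb F}(0,T;L^2_h(\mathcal M))$, the solution $y$ of $$\begin{cases}dy-\sum_{i=1}^2D_i^2y\,dt=\chi_{G_0\cap\mathcal M}u\,dt+v\,dB(t)&\text{in }\mathcal M\times(0,T),\\ y=0&\text{on }\partial\mathcal M\times(0,T),\\ y(0)=y_0&\text{in }\mathcal M,\end{cases}$$ satisfies $$\mathbb E\int_{\mathcal M}\psi\,y(T)=e^{-4T/h^2}\,\mathbb E\int_{\mathcal M}\psi\,y_0.$$ In particular, this quantity does not depend on $(u,v)$ and is nonzero whenever $\mathbb E\int_{\mathcal M}\psi\,y_0\ne0$, so for such $y_0$ no control pair $(u,v)$ drives the solution to $y(T)=0$.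
   Context: $(\Omega,\mathcal F,\{\mathcal F_t\}_{t\ge0},\mathbb P)$ is a complete filtered probability space carrying a one-dimensional standard Brownian motion $B$, with $\{\mathcal F_t\}$ the natural filtration of $B$ augmented by all $\mathbb P$-null sets. $L^2_{\mathcal F_0}(\Omega;H)$ is the space of $\mathcal F_0$-measurable $H$-valued random variables with finite second moment; $L^2_{\mathbb F}(0,T;H)$ is the space of $H$-valued adapted processes $X$ with $\mathbb E\int_0^T|X|_H^2dt<\infty$. With $e_1,e_2$ the canonical basis of $\mathbb R^2$, $\partial\mathcal M$ is the set of points $x\pm he_i$ ($x\in\mathcal M$, $i=1,2$) that are not in $\mathcal M$. $\chi_{G_0\cap\mathcal M}$ is the characteristic function of $G_0\cap\mathcal M$. For $x\in\mathcal M$, $D_i^2y(x)=h^{-2}\big(y(x+he_i)-2y(x)+y(x-he_i)\big)$. For $\mathcal W\subseteq\mathcal M$, $\int_{\mathcal W}u=h^2\sum_{x\in\mathcal W}u(x)$, and $L^2_h(\mathcal W)$ is the space of real functions on $\mathcal W$ with norm $(\int_{\mathcal W}|u|^2)^{1/2}$. *)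

(* Defs.v *)
From HB Require Import structures.
From mathcomp Require Import all_boot all_order all_algebra.
From mathcomp Require Import all_classical all_reals all_analysis.

Set Implicit Arguments.
Unset Strict Implicit.
Unset Printing Implicit Defensive.

Import Order.TTheory GRing.Theory Num.Theory.
Import numFieldNormedType.Exports.

Local Open Scope classical_set_scope.
Local Open Scope ring_scope.

Section Mesh.
Variable R : realType.
Implicit Types (h : R) (x : 'rV[R]_2) (W : set 'rV[R]_2) (f : 'rV[R]_2 -> R).

Definition basis_vec (i : 'I_2) : 'rV[R]_2 := delta_mx ord0 i.

Definition mesh_point h (i j : nat) : 'rV[R]_2 :=
  \row_(k < 2) ((if k == ord0 then i else j)%:R * h).

Definition mesh (N : nat) h : set 'rV[R]_2 :=
  [set x | exists i j : nat,
    [/\ (1 <= i <= N)%N, (1 <= j <= N)%N & x = mesh_point h i j]].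

Definition mesh_boundary (N : nat) h : set 'rV[R]_2 :=
  [set z | ~ mesh N h z /\
    exists x (i : 'I_2), mesh N h x /\
      (z = x + h *: basis_vec i \/ z = x - h *: basis_vec i)].

Definition unit_square : set 'rV[R]_2 :=
  [set x | forall k : 'I_2, 0 < x ord0 k < 1].

Definition D2 h (i : 'I_2) f x : R :=
  h ^- 2 * (f (x + h *: basis_vec i) - 2 * f x + f (x - h *: basis_vec i)).

(* Only used for subsets W of the mesh, for which the sum is finite. *)
Definition mesh_integral h W f : R := h ^+ 2 * \sum_(x \in W) f x.

End Mesh.

Section Stochastic.
Context d (Omega : measurableType d) (R : realType).
Implicit Types (P : probability Omega R) (B : R -> Omega -> R)
  (F : R -> set (set Omega)) (T t h : R) (W : set 'rV[R]_2).

Definition past_events B t : set (set Omega) :=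
  \bigcup_(s in `[0, t]) preimage_set_system setT (B s) measurable.

Definition augmented_filtration P B t : set (set Omega) :=
  <<s past_events B t `|` P.-negligible >>.

(* normal_prob m s takes the standard deviation s, not the variance. *)
Record standard_brownian_motion P B : Prop := StandardBrownianMotion {
  bm_measurable : forall t : R, 0 <= t -> measurable_fun setT (B t) ;
  bm_start : {ae P, forall w, B 0 w = 0} ;
  bm_continuous :
    {ae P, forall w, {within `[0, +oo[, continuous (fun t => B t w)}} ;
  bm_gaussian : forall s t : R, 0 <= s -> s < t ->
    forall C : set R, measurable C ->
      P [set w | C (B t w - B s w)] = normal_prob 0 (Num.sqrt (t - s)) C ;
  bm_independent : forall s t : R, 0 <= s -> s < t ->
    forall (A : set Omega) (C : set R),
      <<s past_events B s >> A -> measurable C ->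
      P (A `&` [set w | C (B t w - B s w)]) =
      (P A * P [set w | C (B t w - B s w)%R])%E }.

Definition measurable_wrt (G : set (set Omega)) (f : Omega -> R) : Prop :=
  forall A : set R, measurable A -> G (f @^-1` A).

(* Simple process \sum_k xi_k 1_{]t_k, t_k+1]} with bounded xi_k that are
   F_{t_k}-measurable. *)
Record simple_process F := SimpleProcess {
  sp_size : nat ;
  sp_time : nat -> R ;
  sp_coef : nat -> Omega -> R ;
  sp_time_ge0 : 0 <= sp_time 0%N ;
  sp_time_le : forall k, (k < sp_size)%N -> sp_time k <= sp_time k.+1 ;
  sp_bounded : exists C : R,
    forall k w, (k < sp_size)%N -> `|sp_coef k w| <= C ;
  sp_adapted : forall k, (k < sp_size)%N ->
    measurable_wrt (F (sp_time k)) (sp_coef k) }.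

Definition sp_value F (phi : simple_process F) (s : R) (w : Omega) : R :=
  \sum_(k < sp_size phi) sp_coef phi k w *
    \1_(`]sp_time phi k, sp_time phi k.+1]) s.

Definition sp_integral B F (phi : simple_process F) (t : R) (w : Omega) : R :=
  \sum_(k < sp_size phi) sp_coef phi k w *
    (B (Num.min (sp_time phi k.+1) t) w - B (Num.min (sp_time phi k) t) w).

(* I is (a version of) the Ito integral of v over [0, t]: the L^2(Omega)-limit
   of the integrals of simple processes converging to v in
   L^2([0, t] x Omega). *)
Definition is_ito_integral P B F (v : R -> Omega -> R) (t : R)
    (I : Omega -> R) : Prop :=
  measurable_fun setT I /\
  exists phi : nat -> simple_process F,
    (fun n => \int[P]_w \int[lebesgue_measure]_(s in `[0%R, t])
        ((sp_value (phi n) s w - v s w) ^+ 2)%R%:E)%E @ \oo --> 0%E /\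
    (fun n => \int[P]_w ((sp_integral B (phi n) t w - I w) ^+ 2)%R%:E)%E
      @ \oo --> 0%E.

(* L^2_{F_0}(Omega; L^2_h(W)); L^2_h(W) is finite dimensional, so
   measurability is pointwise on W, and values off W are irrelevant. *)
Definition L2_initial P F h W (y0 : Omega -> 'rV[R]_2 -> R) : Prop :=
  (forall x, W x -> measurable_wrt (F 0) (fun w => y0 w x)) /\
  (\int[P]_w (mesh_integral h W (fun x => (y0 w x ^+ 2)%R))%:E < +oo)%E.

(* L^2_F(0, T; L^2_h(W)): jointly measurable, adapted, square integrable. *)
Definition L2_adapted P F T h W (X : R -> Omega -> 'rV[R]_2 -> R) : Prop :=
  [/\ forall x, W x ->
        measurable_fun (`[0, T] `*` [set: Omega])
          (fun p : R * Omega => X p.1 p.2 x),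
      forall t x, 0 <= t <= T -> W x ->
        measurable_wrt (F t) (fun w => X t w x)
    & (\int[P]_w \int[lebesgue_measure]_(t in `[0%R, T])
         (mesh_integral h W (fun x => (X t w x ^+ 2)%R))%:E < +oo)%E].

(* The stochastic equation is understood in integrated form; the convergence
   of its terms is guaranteed by the L^2 conditions on y, u and v. *)
Record is_solution P B F T (N : nat) h (G0 : set 'rV[R]_2)
    (u v : R -> Omega -> 'rV[R]_2 -> R) (y0 : Omega -> 'rV[R]_2 -> R)
    (y : R -> Omega -> 'rV[R]_2 -> R) : Prop := IsSolution {
  sol_L2 : L2_adapted P F T h (mesh N h) y ;
  sol_continuous : {ae P, forall w, forall x, mesh N h x ->
    {within `[0, T], continuous (fun t => y t w x)}} ;
  sol_equation : forall t x, 0 <= t <= T -> mesh N h x ->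
    exists I : Omega -> R,
      is_ito_integral P B F (fun s w => v s w x) t I /\
      {ae P, forall w, y t w x = y 0 w x
        + \int[lebesgue_measure]_(s in `[0, t])
            (\sum_(i < 2) D2 h i (y s w) x
             + \1_(G0 `&` mesh N h) x * u s w x)
        + I w} ;
  sol_boundary : {ae P, forall w, forall t x, 0 < t < T ->
    mesh_boundary N h x -> y t w x = 0} ;
  sol_initial : {ae P, forall w, forall x, mesh N h x -> y 0 w x = y0 w x} }.

End Stochastic.

(* Main.v *)
Require Import Defs.
From HB Require Import structures.
From mathcomp Require Import all_boot all_order all_algebra.
From mathcomp Require Import all_classical all_reals all_analysis.
From mathcomp Require Import measurable_realfun ring lra.

Set Implicit Arguments.
Unset Strict Implicit.
Unset Printing Implicit Defensive.

Import Order.TTheory GRing.Theory Num.Theory.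
Import numFieldNormedType.Exports.

Local Open Scope classical_set_scope.
Local Open Scope ring_scope.

(** The vector psi is an eigenvector of the discrete Laplacian for the
eigenvalue -4/h^2, and it does not see the control u.  Indeed, in the sum of
psi times the Laplacian of a function z vanishing on the boundary, the values
of z off the diagonal occur only through the pairs a_k = z((k+1)h, kh) +
z(kh, (k+1)h), each of them once for the diagonal point of index k and once,
with the opposite sign, for the one of index k+1; the alternating sum
telescopes to boundary values ([diag_sum_laplacian]).  Hence, almost surely,
Z(t), the integral of psi y(t) over the mesh, satisfies Z(t) = Z(0) - (4/h^2)
int_0^t Z(s) ds + M(t), where M(t) is a combination of stochastic integrals
([diag_sum_pathwise]).

Taking means, M disappears because a stochastic integral has mean zero
([ito_integral_mean_zero]), and Fubini's theorem ([integral_mean]) gives m(t)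
= m(0) - (4/h^2) int_0^t m(s) ds for m = E Z, whence m(T) = exp(-4T/h^2) m(0)
([exponential_decay], [mean_diag_sum_decay]).

The mean of a stochastic integral is computed from the definition as an L^2
limit of integrals of simple processes.  For these, it suffices that E(xi
(B_t - B_s)) = 0 for xi bounded and F_s-measurable.  When xi is the indicator
of an event A of F_s, the law of B_t - B_s restricted to A is P(A) times a
centred Gaussian ([increment_law_restricted]), which is symmetric; the case
of a general xi follows by successive halving ([halving_bound]). *)

(** * The Gaussian law *)

Section Gaussian.
Variable R : realType.
Local Notation mu := (@lebesgue_measure R).

(** The density of [normal_prob] is identified with its Radon-Nikodym
derivative, to which the change of variables formula applies. *)
Lemma ge0_integral_normal_prob (s : R) (f : R -> \bar R) :
  (forall x, 0 <= f x)%E -> measurable_fun [set: R] f ->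
  (\int[normal_prob 0 s]_x f x = \int[mu]_x (f x * (normal_pdf 0 s x)%:E))%E.
Proof.
move=> f0 mf.
have dom := @normal_prob_dominates R 0 s.
rewrite -(Radon_Nikodym_SigmaFinite.change_of_variables dom) //.
apply: ae_eq_integral => //.
- apply: emeasurable_funM => //.
  exact: measurable_int (Radon_Nikodym_SigmaFinite.f_integrable dom).
- apply: emeasurable_funM => //.
  by apply/measurable_EFinP; exact: measurable_normal_pdf.
- apply: ae_eqe_mul2l; apply: integral_ae_eq => //.
  + exact: Radon_Nikodym_SigmaFinite.f_integrable.
  + by apply/measurable_EFinP; exact: measurable_normal_pdf.
  + by move=> E _ mE; rewrite -Radon_Nikodym_SigmaFinite.f_integral.
Qed.

(** A Gaussian moment is controlled by a wider Gaussian: with v = x/s, it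
comes down to |v| <= 1 + 3/8 v^2 <= exp(3/8 v^2). *)
Lemma normr_normal_pdf_le (s x : R) : 0 < s ->
  `|x| * normal_pdf 0 s x <=
  s * normal_peak s / normal_peak (2 * s) * normal_pdf 0 (2 * s) x.
Proof.
move=> s0; have s20 : 2 * s != 0 by rewrite gt_eqF// mulr_gt0.
rewrite !normal_pdfE ?gt_eqF ?mulr_gt0//.
have p0 := normal_peak_gt0 (lt0r_neq0 s0).
have p20 := normal_peak_gt0 s20.
rewrite mulrA mulrA divfK ?gt_eqF// (mulrC `|x|) -!mulrA.
rewrite [leRHS]mulrCA ler_pM2l// /normal_fun !subr0.
rewrite (_ : - x ^+ 2 / ((2 * s) ^+ 2 *+ 2) =
  3 / 8 * (x / s) ^+ 2 + - x ^+ 2 / (s ^+ 2 *+ 2)); last first.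
  by field; rewrite gt_eqF.
rewrite expRD mulrA ler_pM2r ?expR_gt0//.
have -> : `|x| = s * `|x / s|.
  by rewrite normrM normfV (gtr0_norm s0) mulrC divfK// gt_eqF.
rewrite ler_pM2l// (le_trans _ (expR_ge1Dx _))//.
rewrite -(real_normK (num_real (x / s))).
by have := sqr_ge0 (`|x / s| - 1); have := sqr_ge0 (`|x / s| - 2); nra.
Qed.

Lemma integrable_normal_prob_id (s : R) : 0 < s ->
  (normal_prob 0 s).-integrable [set: R] (EFin : R -> \bar R).
Proof.
move=> s0; apply/integrableP; split; first exact/measurable_EFinP.
rewrite ge0_integral_normal_prob//; last first.
  by apply: measurableT_comp => //; exact/measurable_EFinP.
pose K : R := s * normal_peak s / normal_peak (2 * s).
have K0 : 0 <= K.
  by rewrite divr_ge0 ?mulr_ge0 ?normal_peak_ge0// ltW.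
apply: (@le_lt_trans _ _ (\int[mu]_x (K%:E * (normal_pdf 0 (2 * s) x)%:E))%E).
  apply: ge0_le_integral => //.
  - by move=> x _; rewrite mule_ge0// lee_fin normal_pdf_ge0.
  - apply: emeasurable_funM.
      by apply: measurableT_comp => //; exact/measurable_EFinP.
    by apply/measurable_EFinP; exact: measurable_normal_pdf.
  - apply: emeasurable_funM => //.
    by apply/measurable_EFinP; exact: measurable_normal_pdf.
  - by move=> x _; rewrite -EFinM lee_fin normr_normal_pdf_le.
rewrite ge0_integralZl//; last 2 first.
  by apply/measurable_EFinP; exact: measurable_normal_pdf.
  by move=> x _; rewrite lee_fin normal_pdf_ge0.
by rewrite integral_normal_pdf mule1 ltry.
Qed.

Lemma normal_probN (s : R) (A : set R) : s != 0 -> measurable A ->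
  normal_prob 0 s (-%R @^-1` A) = normal_prob 0 s A.
Proof.
move=> s0 mA.
have mN : measurable_fun [set: R] (-%R : R -> measurableTypeR R) by [].
have mp : measurable_fun A (fun x : R => (normal_pdf 0 s x)%:E).
  by apply/measurable_funTS/measurable_EFinP; exact: measurable_normal_pdf.
rewrite /normal_prob.
transitivity (\int[pushforward mu (-%R : R -> measurableTypeR R)]_(x in A)
    (normal_pdf 0 s x)%:E)%E.
  rewrite ge0_integral_pushforward//; last first.
    by move=> x _; rewrite lee_fin normal_pdf_ge0.
  apply: eq_integral => x _ /=.
  by rewrite !normal_pdfE// /normal_fun !subr0 sqrrN.
by apply: eq_measure_integral => C mC _; exact: lebesgue_measureN.
Qed.

End Gaussian.

(** * The augmented filtration and Brownian increments *)

Section Augmentation.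
Context d (Omega : measurableType d) (R : realType).
Variables (P : probability Omega R) (B : R -> Omega -> R).

(** The events that agree with a past event up to a negligible set form a
sigma-algebra containing the generators.  This carries independence from the
past of B over to the augmented filtration. *)
Lemma augmented_filtration_approx (t : R) (A : set Omega) :
  augmented_filtration P B t A ->
  exists2 A', <<s past_events B t>> A' & P.-negligible (A `+` A').
Proof.
suff : augmented_filtration P B t `<=`
    [set A | exists2 A', <<s past_events B t>> A' & P.-negligible (A `+` A')].
  exact.
have [s0 sD sU] := smallest_sigma_algebra setT (past_events B t).
have n0 := @negligible_set0 _ _ _ P.
apply: smallest_sub => /=; last first.
  move=> C [pC|nC]; last by exists set0 => //; rewrite setY0.
  by exists C; [exact: sub_gen_smallest|rewrite setYK].
split => /=.
- by exists set0 => //; rewrite setYK.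
- move=> C [C' sC' nC]; exists (setT `\` C'); first exact: sD.
  apply: negligibleS nC; rewrite !setTD !setY_def => w.
  by move=> [] [/= nCw /contrapT C'w]; [right|left].
- move=> C HC.
  have /choice[C' HC'] : forall n, exists C', <<s past_events B t>> C' /\
      P.-negligible (C n `+` C').
    by move=> n; have [C' ? ?] := HC n; exists C'.
  exists (\bigcup_n C' n); first by apply: sU => n; have [] := HC' n.
  apply: (@negligibleS _ _ _ _ (\bigcup_n (C n `+` C' n))); last first.
    by apply: negligible_bigcup => n; have [] := HC' n.
  rewrite setY_def => w [] [[n _ Cn]] nC; exists n => //; rewrite setY_def.
    by left; split => // C'n; apply: nC; exists n.
  by right; split => // C'n; apply: nC; exists n.
Qed.

Hypothesis mB : forall t, 0 <= t -> measurable_fun setT (B t).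

Lemma past_measurable (t : R) : <<s past_events B t>> `<=` @measurable _ Omega.
Proof.
apply: smallest_sub; first exact: sigma_algebra_measurable.
move=> A [s /=]; rewrite in_itv/= => /andP[s0 _] [C mC <-].
exact: mB.
Qed.

Lemma augmented_measurable (t : R) : measure_is_complete P ->
  augmented_filtration P B t `<=` @measurable _ Omega.
Proof.
move=> cP; apply: smallest_sub; first exact: sigma_algebra_measurable.
move=> A [pA|nA]; last exact: cP.
by apply: (@past_measurable t); exact: sub_gen_smallest.
Qed.

Lemma measurable_wrt_augmented (t : R) (f : Omega -> R) :
  measure_is_complete P ->
  measurable_wrt (augmented_filtration P B t) f -> measurable_fun setT f.
Proof.
by move=> cP mf _ C mC; rewrite setTI; exact: (augmented_measurable cP (mf _ mC)).
Qed.

End Augmentation.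

Section SymmetricLaw.
Context d (Omega : measurableType d) (R : realType) (P : probability Omega R).

Lemma negligible_setY_measure (A A' : set Omega) :
  measurable A -> measurable A' -> P.-negligible (A `+` A') -> P A = P A'.
Proof.
suff le (C C' : set Omega) : measurable C -> measurable C' ->
    P.-negligible (C `+` C') -> (P C <= P C')%E.
  move=> mA mA' nA; apply/eqP; rewrite eq_le !le//.
  by rewrite setYC.
move=> mC mC' [N [mN N0 CN]].
apply: (@le_trans _ _ (P (C' `|` N))).
  apply: le_measure; rewrite ?inE//; first exact: measurableU.
  move=> w Cw; have [C'w|nC'w] := pselect (C' w); first by left.
  by right; apply: CN; rewrite setY_def; left.
by rewrite (le_trans (measureU2 _ _ _))// [X in (_ + X)%E]N0 adde0.
Qed.

(** X and - X have the same law, hence the same mean. *)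
Lemma integral_symmetric_law (X : Omega -> R) :
  P.-integrable setT (EFin \o X) ->
  (forall C : set R, measurable C -> P (X @^-1` (-%R @^-1` C)) = P (X @^-1` C)) ->
  (\int[P]_w (X w)%:E = 0)%E.
Proof.
move=> iX symX.
have mX : measurable_fun setT X by apply/measurable_EFinP/(measurable_int P).
have iNX : P.-integrable setT (EFin \o (\- X)).
  exact: (integrableN iX).
have mNX : measurable_fun setT (\- X) by exact: measurableT_comp.
have : (\int[P]_w (X w)%:E = \int[P]_w ((\- X) w)%:E)%E.
  rewrite -[LHS](integral_pushforward (D := setT) (f := EFin) mX)//.
  rewrite -[RHS](integral_pushforward (D := setT) (f := EFin) mNX)//.
  apply: eq_measure_integral => C mC _; exact/esym/symX.
rewrite (_ : \int[P]_w ((\- X) w)%:E = - \int[P]_w (X w)%:E)%E; last first.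
  by rewrite -integralN//=; exact: integrable_add_def.
have := integrable_fin_num measurableT iX.
case: (\int[P]_w _)%E => //= r _ [rN]; congr EFin; lra.
Qed.

End SymmetricLaw.

Section Increment.
Context d (Omega : measurableType d) (R : realType).
Variables (P : probability Omega R) (B : R -> Omega -> R).
Hypothesis cP : measure_is_complete P.
Hypothesis hB : standard_brownian_motion P B.
Variables (s t : R).
Hypotheses (s0 : 0 <= s) (st : s < t).
Local Notation dB := (fun w => B t w - B s w).

Let mB (r : R) (r0 : 0 <= r) := bm_measurable hB r0.

Let sd0 : 0 < Num.sqrt (t - s).
Proof. by rewrite sqrtr_gt0 subr_gt0. Qed.

Lemma measurable_increment : measurable_fun setT dB.
Proof. by apply: measurable_funB; apply: mB => //; exact: le_trans (ltW st). Qed.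

Lemma integrable_increment : P.-integrable setT (EFin \o dB).
Proof.
apply/integrableP; split; first exact/measurable_EFinP/measurable_increment.
have /integrableP[_] := integrable_normal_prob_id sd0.
apply: le_lt_trans; rewrite le_eqVlt; apply/orP; left; apply/eqP.
(* The Gaussian law is a measure on the copy measurableTypeR R of R. *)
have mD : measurable_fun setT (dB : Omega -> measurableTypeR R).
  exact: measurable_increment.
rewrite -[LHS](ge0_integral_pushforward mD P
  (f := fun x => `|x%:E|%E) measurableT)//; last first.
  exact/measurableT_comp/measurable_EFinP.
apply: eq_measure_integral => C mC _.
exact: (bm_gaussian hB).
Qed.

(** Both sides are unchanged when A is modified on a negligible set, so that
A may be taken in the sigma-algebra generated by the past of B. *)
Lemma increment_law_restricted (A : set Omega) (C : set R) :
  augmented_filtration P B s A -> measurable C ->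
  P (A `&` dB @^-1` C) = (P A * normal_prob 0 (Num.sqrt (t - s)) C)%E.
Proof.
move=> FA mC; have [A' pA' nA] := augmented_filtration_approx FA.
have mA : measurable A by exact: augmented_measurable FA.
have mA' : measurable A' by exact: past_measurable pA'.
have mDC : measurable (dB @^-1` C).
  by rewrite -[X in measurable X]setTI; exact: measurable_increment.
rewrite (negligible_setY_measure mA mA' nA) -(bm_gaussian hB s0 st mC).
rewrite -(bm_independent hB s0 st pA' mC).
apply: negligible_setY_measure; [exact: measurableI..|].
by rewrite -setIYl; apply: negligibleS nA; exact: subIsetl.
Qed.

(** The law of the product is P(A) times a centred Gaussian plus a mass at 0:
it is symmetric. *)
Lemma integral_increment_indic (A : set Omega) :
  augmented_filtration P B s A ->
  (\int[P]_w (\1_A w * dB w)%:E = 0)%E.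
Proof.
move=> FA.
have mA : measurable A by exact: augmented_measurable FA.
have lawE (C : set R) : measurable C -> P ((fun w => \1_A w * dB w) @^-1` C) =
    (P A * normal_prob 0 (Num.sqrt (t - s)) C + P (~` A) * \d_(0 : R)%R C)%E.
  move=> mC; rewrite -(increment_law_restricted FA mC).
  rewrite (_ : _ @^-1` _ =
      (A `&` dB @^-1` C) `|` (~` A `&` [set _ | C 0])); last first.
    apply/seteqP; split => w /=; rewrite indicE.
      have [wA|wA] := boolP (w \in A); rewrite ?mul1r ?mul0r => ?.
        by left; split => //; exact: set_mem.
      by right; split => // /mem_set; exact/negP.
    case=> -[]; first by move=> /mem_set ->; rewrite mul1r.
    by move=> wA C0; rewrite memNset// mul0r.
  rewrite measureU//; last 3 first.
  - apply: measurableI => //.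
    by rewrite -[X in measurable X]setTI; exact: measurable_increment.
  - apply: measurableI; first exact: measurableC.
    have [C0|C0] := pselect (C 0).
      by rewrite (_ : [set _ | _] = setT)//; apply/seteqP; split.
    by rewrite (_ : [set _ | _] = set0)//; apply/seteqP; split.
  - by rewrite setIACA setICr set0I.
  congr (_ + _)%E; rewrite diracE; have [C0|C0] := boolP (0 \in C).
    rewrite (_ : [set _ | _] = setT) ?setIT ?mule1//.
    by apply/seteqP; split => // w _ /=; exact: set_mem.
  rewrite (_ : [set _ | _] = set0) ?setI0 ?mule0 ?measure0//.
  by apply/seteqP; split => // w /= /mem_set; exact/negP.
apply: integral_symmetric_law.
  apply: (le_integrable measurableT _ _ integrable_increment).
    apply/measurable_EFinP/measurable_funM; last exact: measurable_increment.
    exact: measurable_indic.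
  move=> w _ /=; rewrite lee_fin normrM ler_piMl// indicE.
  by case: (_ \in _); rewrite ?normr1 ?normr0.
move=> C mC; rewrite [LHS]lawE; last first.
  have mN : measurable_fun [set: R] (-%R : R -> R) by [].
  by rewrite -[X in measurable X]setTI; exact: mN.
rewrite lawE// normal_probN ?gt_eqF//; congr (_ + _ * _)%E.
rewrite !diracE; suff -> : (0 \in -%R @^-1` C) = (0 \in C) by [].
by apply/idP/idP; rewrite !inE/= oppr0.
Qed.

End Increment.

Section Orthogonality.
Context d (Omega : measurableType d) (R : realType) (P : probability Omega R).
Variables (G : set (set Omega)) (D : Omega -> R).
Hypothesis mG : G `<=` @measurable _ Omega.
Hypothesis iD : P.-integrable setT (EFin \o D).
Hypothesis D0 : forall A, G A -> (\int[P]_w (\1_A w * D w)%:E = 0)%E.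

Let mD : measurable_fun setT D.
Proof. exact/measurable_EFinP/(measurable_int P). Qed.

Lemma measurable_wrt_comp (f : R -> R) (xi : Omega -> R) :
  measurable_fun setT f -> measurable_wrt G xi -> measurable_wrt G (f \o xi).
Proof.
move=> mf mxi C mC; rewrite comp_preimage; apply: mxi.
by rewrite -[X in measurable X]setTI; exact: mf.
Qed.

Lemma integrable_bounded_mul (xi : Omega -> R) (c : R) :
  measurable_wrt G xi -> (forall w, `|xi w| <= c) ->
  P.-integrable setT (EFin \o (fun w => xi w * D w)).
Proof.
move=> mxi xic.
have mxi' : measurable_fun setT xi.
  by move=> _ C mC; rewrite setTI; apply/mG/mxi.
apply: (le_integrable measurableT _ _ (integrableZl measurableT c iD)).
  exact/measurable_EFinP/measurable_funM.
move=> w _ /=; rewrite lee_fin !normrM ler_wpM2r//.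
by rewrite (le_trans (xic w))// ler_norm.
Qed.

(** Subtracting c/2 from xi where xi >= c/2 does not change the integral,
since it removes a multiple of an indicator of G, and leaves an integrand xi
with values in [0, c/2]. *)
Lemma halving_bound (n : nat) (c : R) (xi : Omega -> R) :
  measurable_wrt G xi -> (forall w, 0 <= xi w <= c) ->
  `|\int[P]_w (xi w * D w)| <= c / 2 ^+ n * \int[P]_w `|D w|.
Proof.
have norm_le b (zeta : Omega -> R) : (forall w, 0 <= zeta w <= b) ->
    forall w, `|zeta w| <= b.
  by move=> zb w; have /andP[z0 ?] := zb w; rewrite ger0_norm.
elim: n c xi => [|n IHn] c xi mxi xic.
  have iX := integrable_bounded_mul mxi (norm_le _ _ xic).
  rewrite divr1 (le_trans (le_normr_Rintegral _ iX))//.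
  rewrite -RintegralZl//; last exact: integrable_norm.
  apply: le_Rintegral => //.
  - exact: integrable_norm.
  - exact: (integrableZl measurableT c (integrable_norm iD)).
  - by move=> w _; rewrite normrM ler_wpM2r// norm_le.
pose A := xi @^-1` `[c / 2, +oo[.
pose f (x : R) := x - c / 2 * \1_(`[c / 2, +oo[) x.
have GA : G A by apply: mxi.
have mf : measurable_fun setT f.
  by apply: measurable_funB => //; apply: measurable_funM => //; exact: measurable_indic.
have fxic w : 0 <= (f \o xi) w <= c / 2.
  have /andP[x0 xc] := xic w.
  by rewrite /f /= indicE mem_setE in_itv/= andbT; case: (leP (c / 2) (xi w)) => ? /=;
    rewrite ?mulr1 ?mulr0; apply/andP; split; lra.
have := IHn (c / 2) (f \o xi) (measurable_wrt_comp mf mxi) fxic.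
have iX := integrable_bounded_mul mxi (norm_le _ _ xic).
have iA : P.-integrable setT (EFin \o (fun w => \1_A w * D w)).
  apply: (le_integrable measurableT _ _ iD).
    by apply/measurable_EFinP/measurable_funM => //; exact/measurable_indic/mG.
  move=> w _ /=; rewrite lee_fin normrM ler_piMl// indicE.
  by case: (_ \in _); rewrite ?normr1 ?normr0.
have -> : \int[P]_w ((f \o xi) w * D w) = \int[P]_w (xi w * D w).
  transitivity (\int[P]_w (xi w * D w - c / 2 * (\1_A w * D w))).
    by apply: eq_Rintegral => w _; rewrite /f /= mulrBl mulrA.
  rewrite RintegralB//; last exact: (integrableZl measurableT (c / 2) iA).
  by rewrite RintegralZl// [X in _ * X]/Rintegral D0//= mulr0 subr0.
by rewrite exprS invfM mulrA.
Qed.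

Lemma integral_bounded_mul (xi : Omega -> R) (c : R) :
  measurable_wrt G xi -> (forall w, `|xi w| <= c) ->
  \int[P]_w (xi w * D w) = 0.
Proof.
move=> mxi xic.
have GT : G setT by have := mxi setT measurableT; rewrite preimage_setT.
have intD : \int[P]_w D w = 0.
  rewrite /Rintegral -[RHS]/(fine 0%E) -(D0 GT); congr fine.
  by apply: eq_integral => w _; rewrite indicT mul1r.
pose zeta := (fun x => x + c) \o xi.
have mzeta : measurable_wrt G zeta.
  by apply: measurable_wrt_comp mxi; exact: measurable_funD.
have zetac w : 0 <= zeta w <= 2 * c.
  have := xic w; rewrite ler_norml /zeta/= => /andP[? ?]; apply/andP; split; lra.
have bound n := halving_bound n mzeta zetac.
have -> : \int[P]_w (xi w * D w) = \int[P]_w (zeta w * D w).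
  transitivity (\int[P]_w (xi w * D w + c * D w)).
    rewrite RintegralD//; last exact: (integrableZl measurableT c iD).
      by rewrite RintegralZl// intD mulr0 addr0.
    exact: integrable_bounded_mul xic.
  by apply: eq_Rintegral => w _; rewrite /zeta/= mulrDl.
apply/eqP; rewrite -normr_le0.
set K := \int[P]_w `|D w| in bound.
have : (fun n => 2 * c / 2 ^+ n * K) @ \oo --> (0 : R).
  rewrite -[X in _ --> X](mul0r K); apply: cvgMl.
  apply: (@cvg_trans _ (geometric (2 * c) (2^-1 : R) @ \oo)).
    by apply: near_eq_cvg; near=> n; rewrite /geometric/= exprVn.
  apply: cvg_geometric; rewrite ger0_norm ?invr_ge0// invf_lt1//; exact: ltr1n.
move=> cvg0; rewrite -(cvg_lim (@Rhausdorff R) cvg0).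
by apply: limr_ge; [exact: cvgP cvg0|exact: nearW].
Unshelve. all: by end_near. Qed.

End Orthogonality.

(** * Mean zero of the stochastic integral *)

Section MeanZeroLimit.
Context d (Omega : measurableType d) (R : realType) (P : probability Omega R).

(** On a probability space, convergence in L^2 implies convergence in L^1,
here through |a| <= e + a^2/e. *)
Lemma mean_zero_L2_limit (X : nat -> Omega -> R) (I : Omega -> R) :
  measurable_fun setT I ->
  (forall n, P.-integrable setT (EFin \o X n)) ->
  (forall n, \int[P]_w X n w = 0) ->
  (fun n => \int[P]_w ((X n w - I w) ^+ 2)%:E)%E @ \oo --> 0%E ->
  P.-integrable setT (EFin \o I) /\ \int[P]_w I w = 0.
Proof.
move=> mI iX X0 XI.
have mX n : measurable_fun setT (X n).
  exact/measurable_EFinP/(measurable_int P).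
have L1 (e : R) : 0 < e ->
    exists n, (\int[P]_w `|(X n w - I w)%:E| <= (2 * e)%:E)%E.
  move=> e0.
  have [n /ltW Jn] : exists n,
      (\int[P]_w ((X n w - I w) ^+ 2)%:E < (e ^+ 2)%:E)%E.
    have /fine_cvgP[fin /cvgr_lt/(_ (e ^+ 2)) lt] := XI.
    near \oo => n; exists n; rewrite -[ltLHS]fineK; last by near: n.
    by rewrite lte_fin; near: n; apply: lt; rewrite exprn_gt0.
  exists n.
  have msq : measurable_fun setT (fun w => (X n w - I w) ^+ 2).
    by apply: measurable_funX; exact: measurable_funB.
  apply: (@le_trans _ _ (\int[P]_w (e%:E + e^-1%:E * ((X n w - I w) ^+ 2)%:E))%E).
    apply: ge0_le_integral => //.
    - by apply/measurable_EFinP/measurableT_comp => //; exact: measurable_funB.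
    - apply: emeasurable_funD => //; apply: emeasurable_funM => //.
      exact/measurable_EFinP.
    - move=> w _ /=; rewrite -EFinM -EFinD lee_fin.
      set a := X n w - I w; rewrite -(real_normK (num_real a)).
      rewrite -(ler_pM2l e0) mulrDr mulVKf ?gt_eqF//.
      by have := sqr_ge0 (`|a| - e); have := normr_ge0 a; nra.
  rewrite ge0_integralD//; last 3 first.
  - by move=> w _; rewrite lee_fin ltW.
  - by move=> w _; rewrite -EFinM lee_fin mulr_ge0 ?sqr_ge0// invr_ge0 ltW.
  - by apply: emeasurable_funM => //; exact/measurable_EFinP.
  rewrite integral_cst// [X in (_ * X)%E]probability_setT mule1
    ge0_integralZl//; last 3 first.
  - exact/measurable_EFinP.
  - by move=> w _; rewrite lee_fin sqr_ge0.
  - by rewrite lee_fin invr_ge0 ltW.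
  rewrite mulr_natl mulr2n EFinD leeD2l//.
  apply: (@le_trans _ _ (e^-1%:E * (e ^+ 2)%:E)%E).
    by apply: lee_wpmul2l => //; rewrite lee_fin invr_ge0 ltW.
  by rewrite -EFinM lee_fin expr2 mulKf ?gt_eqF.
have mXI n : measurable_fun setT (EFin \o (fun w => X n w - I w)).
  by apply/measurable_EFinP; exact: measurable_funB.
have iXI n e : (\int[P]_w `|(X n w - I w)%:E| <= (2 * e)%:E)%E ->
    P.-integrable setT (EFin \o (fun w => X n w - I w)).
  by move=> le; apply/integrableP; split => //; rewrite (le_lt_trans le) ?ltry.
have iI : P.-integrable setT (EFin \o I).
  have [n Jn] := L1 1 ltr01.
  apply: eq_integrable (integrableB measurableT (iX n) (iXI _ _ Jn)) => // w _.
  by rewrite /= -EFinB opprB addrC subrK.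
split=> //; apply/eqP; rewrite -normr_le0; apply/ler_addgt0Pr => e e0.
rewrite add0r.
have [n Jn] := L1 _ (divr_gt0 e0 (ltr0Sn R 1)).
have -> : `|\int[P]_w I w| = `|\int[P]_w (X n w - I w)|.
  by rewrite RintegralB// X0 sub0r normrN.
rewrite (le_trans (le_normr_Rintegral _ (iXI _ _ Jn)))//.
rewrite -lee_fin fineK; last first.
  exact: integrable_fin_num (integrable_norm (iXI _ _ Jn)).
by rewrite (le_trans Jn)// lee_fin; lra.
Unshelve. all: by end_near. Qed.

End MeanZeroLimit.

Section ItoMean.
Context d (Omega : measurableType d) (R : realType).
Variables (P : probability Omega R) (B : R -> Omega -> R).
Hypothesis cP : measure_is_complete P.
Hypothesis hB : standard_brownian_motion P B.
Local Notation F := (augmented_filtration P B).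

Lemma sp_time_nonneg (phi : simple_process F) (k : nat) :
  (k <= sp_size phi)%N -> 0 <= sp_time phi k.
Proof.
elim: k => [|k IHk] ks; first exact: sp_time_ge0.
by rewrite (le_trans (IHk (ltnW ks)))// sp_time_le.
Qed.

(** The term of index k vanishes when t <= t_k; otherwise min(t_k, t) = t_k,
and the term is the product of an F_{t_k}-measurable bounded coefficient and
an increment starting at t_k. *)
Lemma sp_integral_mean_zero (phi : simple_process F) (t : R) :
  P.-integrable setT (EFin \o sp_integral B phi t) /\
  \int[P]_w sp_integral B phi t w = 0.
Proof.
pose X k w := sp_coef phi k w *
    (B (Num.min (sp_time phi k.+1) t) w - B (Num.min (sp_time phi k) t) w).
have [C coefC] := sp_bounded phi.
have XP k : (k < sp_size phi)%N ->
    P.-integrable setT (EFin \o X k) /\ \int[P]_w X k w = 0.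
  move=> ks; pose s := Num.min (sp_time phi k) t.
  pose r := Num.min (sp_time phi k.+1) t.
  have sr : s <= r.
    by rewrite /s /r le_min !ge_min lexx (sp_time_le ks) orbT.
  have [rs|rs] := eqVneq r s.
    have -> : X k = cst 0 by apply/funext => w; rewrite /X -/r -/s rs subrr mulr0.
    by split; [exact: integrable0|rewrite Rintegral_cst// mul0r].
  have {rs}sr : s < r by rewrite lt_neqAle eq_sym rs.
  have sE : s = sp_time phi k.
    rewrite /s; apply/min_idPl; rewrite leNgt; apply/negP => ts.
    move: sr; rewrite /s (min_idPr (ltW ts)) /r (min_idPr _) ?ltxx//.
    by rewrite (le_trans (ltW ts))// sp_time_le.
  have s0 : 0 <= s by rewrite sE sp_time_nonneg// ltnW.
  have mF : F s `<=` @measurable _ Omega.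
    exact: augmented_measurable (bm_measurable hB) s cP.
  have iD := integrable_increment hB s0 sr.
  have D0 := integral_increment_indic cP hB s0 sr.
  have mxi : measurable_wrt (F s) (sp_coef phi k).
    by rewrite sE; exact: sp_adapted.
  have xiC w : `|sp_coef phi k w| <= C by exact: coefC.
  split; first exact: (integrable_bounded_mul mF iD mxi xiC).
  exact: (integral_bounded_mul mF iD D0 mxi xiC).
have spE : EFin \o sp_integral B phi t =
    fun w => (\sum_(k < sp_size phi) (EFin \o X k) w)%E.
  by apply/funext => w; rewrite /= /sp_integral sumEFin.
have iX (k : 'I_(sp_size phi)) : P.-integrable setT (EFin \o X k).
  exact: (XP k (ltn_ord k)).1.
rewrite /Rintegral (_ : (fun w => _%:E) = EFin \o sp_integral B phi t)// spE.
split; first exact: integrable_sum.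
rewrite integral_sum// big1// => k _.
have [iXk X0] := XP k (ltn_ord k).
rewrite -[LHS]fineK ?(integrable_fin_num measurableT iXk)//.
by rewrite -[fine _]/(\int[P]_w X k w) X0.
Qed.

Lemma ito_integral_mean_zero (v : R -> Omega -> R) (t : R) (I : Omega -> R) :
  is_ito_integral P B F v t I ->
  P.-integrable setT (EFin \o I) /\ \int[P]_w I w = 0.
Proof.
case=> mI [phi [_ phiI]].
apply: (mean_zero_L2_limit mI _ _ phiI) => n.
  exact: (sp_integral_mean_zero (phi n) t).1.
exact: (sp_integral_mean_zero (phi n) t).2.
Qed.

End ItoMean.

(** * Mesh sums *)

Section MeshAlgebra.
Variable R : realType.
Implicit Types (h : R) (z : 'rV[R]_2 -> R).

Lemma mesh_point_inj h (i j i' j' : nat) : h != 0 ->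
  mesh_point h i j = mesh_point h i' j' -> i = i' /\ j = j'.
Proof.
move=> h0 /rowP eqp.
have := eqp ord0; have := eqp ord_max; rewrite !mxE /=.
by move=> /(mulIf h0)/eqP; rewrite eqr_nat => /eqP -> /(mulIf h0)/eqP;
  rewrite eqr_nat => /eqP ->.
Qed.

Lemma mesh_point_add0 h (i j : nat) :
  mesh_point h i j + h *: basis_vec R ord0 = mesh_point h i.+1 j.
Proof.
apply/rowP => k; rewrite !mxE eqxx/=; case: ifP => k0.
  by rewrite mulr1 -natr1 mulrDl mul1r.
by rewrite mulr0 addr0.
Qed.

Lemma mesh_point_add1 h (i j : nat) :
  mesh_point h i j + h *: basis_vec R ord_max = mesh_point h i j.+1.
Proof.
apply/rowP => k; rewrite !mxE eqxx/=.
case: (splitP (k : 'I_(1 + 1))) => l kl; rewrite (ord1 l) in kl.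
  have -> : k = ord0 by exact: val_inj.
  by rewrite /= mulr0 addr0.
have -> : k = ord_max by exact: val_inj.
by rewrite /= mulr1 -natr1 mulrDl mul1r.
Qed.

Lemma mesh_point_sub0 h (i j : nat) :
  mesh_point h i.+1 j - h *: basis_vec R ord0 = mesh_point h i j.
Proof. by rewrite -mesh_point_add0 addrK. Qed.

Lemma mesh_point_sub1 h (i j : nat) :
  mesh_point h i j.+1 - h *: basis_vec R ord_max = mesh_point h i j.
Proof. by rewrite -mesh_point_add1 addrK. Qed.

Lemma mesh_integralE h (N : nat) z : h != 0 ->
  mesh_integral h (mesh N h) z =
  h ^+ 2 * \sum_(i < N) \sum_(j < N) z (mesh_point h i.+1 j.+1).
Proof.
move=> h0; rewrite /mesh_integral; congr (_ * _).
pose r := [seq mesh_point h i.+1 j.+1 | i <- iota 0 N, j <- iota 0 N].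
have -> : mesh N h = [set` r].
  apply/seteqP; split => x /=.
    case=> -[|i] [[|j] [//= iN jN ->]]; apply/allpairsP; exists (i, j).
    by rewrite !mem_iota.
  case/allpairsP => -[i j] /= [] /[!mem_iota] /= iN jN ->.
  by exists i.+1, j.+1.
rewrite -fsbig_seq; last first.
  apply: allpairs_uniq; [exact: iota_uniq..|].
  by move=> [i j] [i' j'] _ _ /= /(mesh_point_inj h0)[[->] [->]].
by rewrite big_allpairs_dep -{1 2}(subn0 N) -/(index_iota 0 N) big_mkord;
  apply: eq_bigr => i _; rewrite -/(index_iota 0 N) big_mkord.
Qed.

Lemma mesh_integral_sqr_ge0 (h : R) (N : nat) (z : 'rV[R]_2 -> R) : h != 0 ->
  0 <= mesh_integral h (mesh N h) (fun x => z x ^+ 2).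
Proof.
move=> h0; rewrite mesh_integralE// mulr_ge0 ?sqr_ge0// sumr_ge0// => i _.
by rewrite sumr_ge0// => j _; exact: sqr_ge0.
Qed.

Lemma mesh_diag (h : R) (N : nat) (k : 'I_N) :
  mesh N h (mesh_point h k.+1 k.+1).
Proof. by exists k.+1, k.+1; rewrite !ltn_ord. Qed.

(** The integral of psi z over the mesh, written on the diagonal, where psi
is concentrated. *)
Definition diag_sum h (N : nat) z : R :=
  h ^+ 2 * \sum_(k < N) (-1) ^+ k.+1 * z (mesh_point h k.+1 k.+1).

Lemma mesh_integral_diag h (N : nat) (psi z : 'rV[R]_2 -> R) : h != 0 ->
  (forall i j : nat, (1 <= i <= N)%N -> (1 <= j <= N)%N ->
    psi (mesh_point h i j) = if i == j then (-1) ^+ i else 0) ->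
  mesh_integral h (mesh N h) (fun x => psi x * z x) = diag_sum h N z.
Proof.
move=> h0 psiE; rewrite mesh_integralE//; congr (_ * _).
apply: eq_bigr => i _; rewrite (bigD1 i)//= psiE ?ltn_ord// eqxx.
rewrite big1 ?addr0// => j ji.
by rewrite psiE ?ltn_ord// eqSS eq_sym (negbTE ji : (j == i :> nat) = false) mul0r.
Qed.

(** Adjacent diagonal points share their two off-diagonal neighbours and
carry opposite signs, so that only the outer neighbours of the first and last
ones survive; these lie on the boundary. *)
Lemma diag_sum_laplacian h (N : nat) z : h != 0 ->
  (forall x, mesh_boundary N h x -> z x = 0) ->
  diag_sum h N (fun x => \sum_(i < 2) D2 h i z x) =
  - (4 / h ^+ 2) * diag_sum h N z.
Proof.
move=> h0 z0.
pose a (k : nat) := z (mesh_point h k.+1 k) + z (mesh_point h k k.+1).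
have step (k : nat) :
    \sum_(i < 2) D2 h i z (mesh_point h k.+1 k.+1) =
    h ^- 2 * (a k.+1 + a k - 4 * z (mesh_point h k.+1 k.+1)).
  rewrite big_ord_recl big_ord1 (_ : lift ord0 ord0 = ord_max); last exact: val_inj.
  rewrite /D2 mesh_point_add0 mesh_point_sub0 mesh_point_add1 mesh_point_sub1.
  by rewrite /a; ring.
have telescope (n : nat) :
    \sum_(k < n) (-1) ^+ k.+1 * (a k.+1 + a k) = (-1) ^+ n * a n - a 0%N.
  elim: n => [|n IHn]; first by rewrite big_ord0 expr0 mul1r subrr.
  by rewrite big_ord_recr/= IHn exprS; ring.
have ends : (-1) ^+ N * a N - a 0%N = 0.
  case: N z0 {telescope} => [|n] z0; first by rewrite expr0 mul1r subrr.
  have inmesh (i j : nat) : (1 <= i <= n.+1)%N -> (1 <= j <= n.+1)%N ->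
      mesh n.+1 h (mesh_point h i j) by move=> ? ?; exists i, j.
  have outmesh (i j : nat) : ~~ ((1 <= i <= n.+1)%N && (1 <= j <= n.+1)%N) ->
      ~ mesh n.+1 h (mesh_point h i j).
    move=> out [i' [j' [i'n j'n /(mesh_point_inj h0)[ii' jj']]]].
    by move: out; rewrite ii' jj' i'n j'n.
  have a0 : a 0%N = 0.
    rewrite /a !z0 ?addr0//; (split; first exact: outmesh).
      exists (mesh_point h 1 1), ord0; split; first exact: inmesh.
      by right; rewrite mesh_point_sub0.
    exists (mesh_point h 1 1), ord_max; split; first exact: inmesh.
    by right; rewrite mesh_point_sub1.
  have aN : a n.+1 = 0.
    have nn : (1 <= n.+1 <= n.+1)%N by rewrite leqnn.
    have out : (1 <= n.+2 <= n.+1)%N = false by rewrite ltnn andbF.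
    rewrite /a !z0 ?addr0//.
      split; first by apply: outmesh; rewrite out andbF.
      exists (mesh_point h n.+1 n.+1), ord_max; split; first exact: inmesh.
      by left; rewrite mesh_point_add1.
    split; first by apply: outmesh; rewrite out.
    exists (mesh_point h n.+1 n.+1), ord0; split; first exact: inmesh.
    by left; rewrite mesh_point_add0.
  by rewrite aN a0 mulr0 subrr.
rewrite /diag_sum; under eq_bigr do rewrite step.
rewrite (eq_bigr (fun k : 'I_N => h ^- 2 * ((-1) ^+ k.+1 * (a k.+1 + a k)) -
    4 / h ^+ 2 * ((-1) ^+ k.+1 * z (mesh_point h k.+1 k.+1)))); last first.
  by move=> k _; ring.
rewrite sumrB -!mulr_sumr telescope ends mulr0 sub0r.
by rewrite mulrCA mulNr.
Qed.

End MeshAlgebra.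

(** * The integral equation for the mean *)

Section Decay.
Variable R : realType.
Local Notation mu := (@lebesgue_measure R).

(** A solution of the integral equation is continuous, hence differentiable
inside the interval, and t |-> exp(ct) m(t) has derivative zero there. *)
Lemma exponential_decay (m : R -> R) (c T : R) : 0 < T ->
  mu.-integrable `[0, T] (EFin \o m) ->
  (forall t, 0 <= t <= T -> m t = m 0 - c * \int[mu]_(s in `[0, t]) m s) ->
  m T = expR (- (c * T)) * m 0.
Proof.
move=> T0 im mE.
pose M t := \int[mu]_(s in `[0, t]) m s.
have cM : {within `[0, T], continuous M}.
  exact: parameterized_integral_continuous (ltW T0) im.
pose n t := m 0 - c * M t.
have nm t : 0 <= t <= T -> n t = m t by move=> tT; exact/esym/mE.
have in0T t : t \in `]0, T[ -> 0 <= t <= T.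
  by rewrite in_itv/= => /andP[t0 tT]; rewrite !ltW.
have cn : {within `[0, T], continuous n}.
  by move=> x; apply: cvgB; [exact: cvg_cst|apply: cvgM; [exact: cvg_cst|exact: cM]].
have intE t : 0 <= t <= T -> \int[mu]_(s in `[0, t]) n s = M t.
  move=> /andP[_ tT]; apply: eq_Rintegral => s; rewrite inE/= in_itv/= => /andP[s0 st].
  by rewrite nm// s0 (le_trans st).
have in_ : mu.-integrable `[0, T] (EFin \o n).
  apply: eq_integrable im => // s; rewrite inE/= in_itv/= => sT.
  by rewrite nm.
pose Nn t := \int[mu]_(s in `[0, t]) n s.
have cN : {within `[0, T], continuous Nn}.
  exact: parameterized_integral_continuous (ltW T0) in_.
pose g t := expR (c * t) * (m 0 - c * Nn t).
have dg x : x \in `]0, T[ -> is_derive x 1 g 0.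
  move=> xT; have := xT; rewrite in_itv/= => /andP[x0 xlT].
  have cnx : {for x, continuous n} by exact: within_continuous_continuous cn xT.
  have [dN N'] := continuous_FTC1_closed xlT in_ x0 cnx.
  have dNx : is_derive x 1 Nn (n x).
    by apply: DeriveDef; [exact: dN|rewrite -derive1E N'].
  have dcx : is_derive x 1 (fun t : R => c * t) c.
    by have := is_deriveZ c (is_derive_id x (1 : R)); rewrite /GRing.scale/= mulr1.
  have de : is_derive x 1 (fun t => expR (c * t)) (expR (c * x) * c).
    exact: is_derive1_comp.
  have dm : is_derive x 1 (fun t => m 0 - c * Nn t) (0 - c * n x).
    by apply: is_deriveB; exact: is_deriveZ.
  apply: (is_derive_eq (is_deriveM de dm)).
  rewrite /GRing.scale/= /Nn (intE _ (in0T _ xT)) -/(n x); ring.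
have cg : {within `[0, T], continuous g}.
  move=> x; apply: cvgM; last first.
    by apply: cvgB; [exact: cvg_cst|apply: cvgM; [exact: cvg_cst|exact: cN]].
  apply: (@continuous_subspaceT _ _ _ (fun t : R => expR (c * t))) => y.
  apply: continuous_comp; last exact: continuous_expR.
  exact: mulrl_continuous.
have [y _] := MVT T0 dg cg.
rewrite mul0r => /eqP; rewrite subr_eq0 => /eqP.
have T0T : 0 <= T <= T by rewrite lexx ltW.
rewrite /g /Nn (intE _ T0T) -/(n T) nm// mulr0 expR0 mul1r set_itv1 Rintegral_set1.
by rewrite mulr0 subr0 => <-; rewrite mulrA -expRD addNr expR0 mul1r.
Qed.

End Decay.

(** * Fubini's theorem on a time slab *)

Section SlabFubini.
Context d (Omega : measurableType d) (R : realType) (P : probability Omega R).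
Local Notation mu := (@lebesgue_measure R).

Definition slab (t : R) : set (measurableTypeR R * Omega) :=
  `[0, t] `*` [set: Omega].

(** The extension by 0 of a process on [0, t] to all times, as a function on
the product space: this is the form in which Fubini's theorem applies. *)
Definition slab_restrict (t : R) (X : R -> Omega -> R) :
    measurableTypeR R * Omega -> \bar R :=
  (fun p => (X p.1 p.2)%:E) \_ (slab t).

Lemma slab_restrictE (t : R) (X : R -> Omega -> R) (s : R) (w : Omega) :
  slab_restrict t X (s, w) = ((fun r => (X r w)%:E) \_ `[0, t]) s.
Proof. by rewrite /slab_restrict !patchE in_setX in_setT andbT. Qed.

Lemma measurable_slab (t : R) : measurable (slab t).
Proof. exact: measurableX. Qed.

Lemma measurable_slab_restrict (t : R) (X : R -> Omega -> R) :
  measurable_fun (slab t) (fun p => X p.1 p.2) ->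
  measurable_fun setT (slab_restrict t X).
Proof.
move=> mX; apply/measurable_restrict => //; first exact: measurable_slab.
by rewrite setTI; exact/measurable_EFinP.
Qed.

Lemma ge0_integrable_slab (t : R) (X : R -> Omega -> R) :
  measurable_fun (slab t) (fun p => X p.1 p.2) ->
  (forall s w, 0 <= X s w) ->
  (\int[P]_w \int[mu]_(s in `[0%R, t]) (X s w)%:E < +oo)%E ->
  (mu \x P)%E.-integrable setT (slab_restrict t X).
Proof.
move=> mX X0 Xoo; apply/integrable21ltyP; first exact: measurable_slab_restrict.
apply: le_lt_trans Xoo; rewrite le_eqVlt; apply/orP; left; apply/eqP.
apply: eq_integral => w _; rewrite [RHS]integral_mkcond.
apply: eq_integral => s _; rewrite slab_restrictE gee0_abs// patchE.
by case: ifP => // _; rewrite lee_fin.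
Qed.

Variables (T : R) (Z : R -> Omega -> R).
Hypothesis mZ : measurable_fun (slab T) (fun p => Z p.1 p.2).
Hypothesis iZ : (mu \x P)%E.-integrable setT (slab_restrict T Z).

Lemma integrable_mean :
  mu.-integrable `[0, T] (fun s => \int[P]_w (Z s w)%:E)%E.
Proof.
rewrite integrable_mkcond//.
apply: eq_integrable (integrable_fubini_F iZ) => //= s _.
rewrite /fubini_F; under eq_integral do rewrite slab_restrictE.
rewrite patchE; case: ifPn => sT.
  by apply: eq_integral => w _; rewrite patchE sT.
by rewrite integral0_eq// => w _; rewrite patchE (negbTE sT).
Qed.

(** The time integral is known to converge only for almost every w; elsewhere
[Rintegral] takes a default value, which does not affect the mean. *)
Lemma integral_mean (t : R) : t <= T ->
  P.-integrable setT (EFin \o (fun w => \int[mu]_(s in `[0, t]) Z s w)) /\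
  (\int[P]_w (\int[mu]_(s in `[0, t]) Z s w)%R%:E =
   \int[mu]_(s in `[0%R, t]) \int[P]_w (Z s w)%:E)%E.
Proof.
move=> tT.
have sub : slab t `<=` slab T.
  by move=> [s w] [/= + _]; rewrite in_itv/= => /andP[s0 st]; split=> //=;
    rewrite in_itv/= s0 (le_trans st).
have mZt : measurable_fun (slab t) (fun p => Z p.1 p.2).
  exact: measurable_funS (measurable_slab T) sub mZ.
have iZt : (mu \x P)%E.-integrable setT (slab_restrict t Z).
  apply: le_integrable iZ => //; first exact: measurable_slab_restrict.
  move=> p _; rewrite /slab_restrict !patchE; case: ifPn => [pt|_].
    by rewrite (mem_set (sub _ (set_mem pt))).
  by rewrite abse0 abse_ge0.
pose J w := (\int[mu]_(s in `[0%R, t]) (Z s w)%:E)%E.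
have JE : fubini_G mu (slab_restrict t Z) = J.
  apply/funext => w; rewrite /J [RHS]integral_mkcond.
  by apply: eq_integral => s _; rewrite slab_restrictE.
have mJ : measurable_fun setT J by rewrite -JE; exact: measurable_fubini_G iZt.
have mf := measurable_int _ iZt.
have iJ : P.-integrable setT J.
  apply/integrableP; split => //.
  apply: le_lt_trans ((integrable21ltyP mu P mf).1 iZt).
  apply: ge0_le_integral => //; first exact: measurableT_comp.
  - apply: (measurable_fun_fubini_tonelli_G (abse \o slab_restrict t Z)) => //=.
    exact: measurableT_comp.
  - move=> w _; rewrite -JE; apply: le_abse_integral => //.
    exact: measurable_fun_pair1 mf.
have mfJ : measurable_fun setT (fun w => fine (J w)).
  by apply: measurableT_comp mJ; exact: fine_measurable.
split.
  apply: le_integrable iJ => //; first exact/measurable_EFinP.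
  by move=> w _; rewrite /= /Rintegral -/(J w); case: (J w) => //=; rewrite normr0 leey.
transitivity (\int[P]_w J w)%E.
  apply: ae_eq_integral => //; first exact/measurable_EFinP.
  apply: filterS (integrable_ae measurableT iJ) => w /= /(_ Logic.I) Jw _.
  by rewrite /Rintegral -/(J w) fineK.
rewrite -JE -[LHS](Fubini iZt) [RHS]integral_mkcond; apply: eq_integral => s _.
under eq_integral do rewrite slab_restrictE.
rewrite patchE; case: ifPn => sT.
  by apply: eq_integral => w _; rewrite patchE sT.
by rewrite integral0_eq// => w _; rewrite patchE (negbTE sT).
Qed.

End SlabFubini.

Section DiagSum.
Variable R : realType.

(** The bound |a| <= 1 + a^2 at each diagonal point turns square
integrability over the mesh into integrability. *)
Lemma le_normr_diag_sum (h : R) (N : nat) (z : 'rV[R]_2 -> R) : h != 0 ->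
  `|diag_sum h N z| <=
  h ^+ 2 * N%:R + mesh_integral h (mesh N h) (fun x => z x ^+ 2).
Proof.
move=> h0; rewrite mesh_integralE// /diag_sum normrM ger0_norm ?sqr_ge0//.
rewrite -mulrDr ler_wpM2l ?sqr_ge0// (le_trans (ler_norm_sum _ _ _))//.
rewrite -[X in X%:R]card_ord -sumr_const -big_split/=; apply: ler_sum => k _.
rewrite normrM normrX normrN1 expr1n mul1r (bigD1 k)//=.
set a := z _; have : `|a| <= 1 + a ^+ 2.
  rewrite -(real_normK (num_real a)).
  by have := sqr_ge0 (`|a| - 1); have := normr_ge0 a; nra.
move=> /le_trans; apply; rewrite addrA lerDl sumr_ge0// => j _.
exact: sqr_ge0.
Qed.

Lemma Rintegral_diag_sum d (U : measurableType d) (m : {measure set U -> \bar R})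
    (D : set U) (h : R) (N : nat) (g : U -> 'rV[R]_2 -> R) : measurable D ->
  (forall k : 'I_N,
    m.-integrable D (EFin \o (fun s => g s (mesh_point h k.+1 k.+1)))) ->
  m.-integrable D (EFin \o (fun s => diag_sum h N (g s))) /\
  \int[m]_(s in D) diag_sum h N (g s) =
  diag_sum h N (fun x => \int[m]_(s in D) g s x).
Proof.
move=> mD ig.
pose X (k : 'I_N) s := h ^+ 2 * (-1) ^+ k.+1 * g s (mesh_point h k.+1 k.+1).
have iX k : m.-integrable D (EFin \o X k).
  exact: (integrableZl mD (h ^+ 2 * (-1) ^+ k.+1) (ig k)).
have sE s : diag_sum h N (g s) = \sum_(k < N) X k s.
  by rewrite /diag_sum mulr_sumr; apply: eq_bigr => k _; rewrite /X mulrA.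
have -> : EFin \o (fun s => diag_sum h N (g s)) =
    fun s => (\sum_(k < N) (EFin \o X k) s)%E.
  by apply/funext => s; rewrite /= sE sumEFin.
split; first exact: integrable_sum.
rewrite /Rintegral; under eq_integral do rewrite sE -sumEFin.
rewrite integral_sum// -sum_fine; last first.
  by move=> k _; exact: integrable_fin_num (iX k).
rewrite /diag_sum mulr_sumr; apply: eq_bigr => k _.
by rewrite -/(Rintegral m D (X k)) RintegralZl// mulrA.
Qed.

(** The neighbours of a diagonal point lie in the mesh, where paths are
continuous, or on the boundary, where they vanish for 0 < s < T; each term of
the Laplacian is thus integrable in time, and the sum over the diagonal may
be taken under the integral. *)
Lemma diag_sum_pathwise (N : nat) (h T t : R) (z : R -> 'rV[R]_2 -> R)
    (I : 'rV[R]_2 -> R) : h != 0 -> 0 <= t <= T ->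
  (forall x, mesh N h x -> {within `[0, T], continuous (z^~ x)}) ->
  (forall s x, 0 < s < T -> mesh_boundary N h x -> z s x = 0) ->
  (forall k : 'I_N, let x := mesh_point h k.+1 k.+1 in
    z t x = z 0 x +
      \int[lebesgue_measure]_(s in `[0, t]) (\sum_(i < 2) D2 h i (z s) x) +
      I x) ->
  diag_sum h N (z t) = diag_sum h N (z 0)
    - 4 / h ^+ 2 * (\int[lebesgue_measure]_(s in `[0, t]) diag_sum h N (z s))
    + diag_sum h N I.
Proof.
move=> h0 /andP[t0 tT] cz bz eqz.
(* The extension of z(s) by 0 off the mesh agrees with z(s) on the
   mesh and its boundary for 0 < s < T, is continuous in s on [0, T],
   and vanishes on the boundary for every s, the endpoints included. *)
pose zt s x := if `[< mesh N h x >] then z s x else 0.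
have cut : {subset `[0, t] <= `[0, T]}.
  by move=> s; rewrite !in_itv/= => /andP[-> /le_trans ->].
have czt x : {within `[0, t], continuous (zt^~ x)}.
  rewrite /zt; case: asboolP => [mx|_].
    by apply: continuous_subspaceW (cz _ mx) => s /cut.
  by move=> s; exact: cvg_cst.
pose lap s x := \sum_(i < 2) D2 h i (zt s) x.
have cD2 i x : {within `[0, t], continuous (fun s => D2 h i (zt s) x)}.
  move=> s; apply: cvgM; first exact: cvg_cst.
  apply: cvgD; last exact: czt.
  apply: cvgB; first exact: czt.
  by apply: cvgM; [exact: cvg_cst|exact: czt].
have clap x : {within `[0, t], continuous (lap^~ x)}.
  rewrite (_ : lap^~ x = fun s =>
      D2 h ord0 (zt s) x + D2 h (lift ord0 ord0) (zt s) x).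
    by move=> s; apply: cvgD; exact: cD2.
  by apply/funext => s; rewrite /lap big_ord_recl big_ord1.
have ilap x : lebesgue_measure.-integrable `[0, t] (EFin \o lap^~ x).
  by apply: continuous_compact_integrable; [exact: segment_compact|exact: clap].
have lapE (k : 'I_N) s : s \in `]0, t[ ->
    \sum_(i < 2) D2 h i (z s) (mesh_point h k.+1 k.+1) =
    lap s (mesh_point h k.+1 k.+1).
  rewrite in_itv/= => /andP[s0 st].
  have sT : 0 < s < T by rewrite s0 (lt_le_trans st).
  apply: eq_bigr => i _; congr (_ * (_ - 2 * _ + _)); rewrite /zt.
  - case: asboolP => // nx; apply: bz => //; split => //.
    by exists (mesh_point h k.+1 k.+1), i; split; [exact: mesh_diag|left].
  - by case: asboolP => // /(_ (mesh_diag h k)).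
  - case: asboolP => // nx; apply: bz => //; split => //.
    by exists (mesh_point h k.+1 k.+1), i; split; [exact: mesh_diag|right].
have intE (k : 'I_N) : let x := mesh_point h k.+1 k.+1 in
    \int[lebesgue_measure]_(s in `[0, t]) (\sum_(i < 2) D2 h i (z s) x) =
    \int[lebesgue_measure]_(s in `[0, t]) lap s x.
  move=> x; rewrite /Rintegral; congr fine.
  have ml : measurable_fun `]0, t[ (EFin \o lap^~ x).
    apply: measurable_funS (measurable_int _ (ilap x)) => //.
    exact: subset_itv_oo_cc.
  rewrite [LHS]integral_itv_bndoo; last first.
    by apply: eq_measurable_fun ml => s; rewrite inE => st; rewrite /= lapE.
  rewrite [RHS]integral_itv_bndoo//.
  by apply: eq_integral => s; rewrite inE => st; rewrite lapE.
have sumlap s : diag_sum h N (lap s) = - (4 / h ^+ 2) * diag_sum h N (z s).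
  rewrite diag_sum_laplacian//; last first.
    by move=> x [nx _]; rewrite /zt; case: asboolP.
  congr (_ * (_ * _)); apply: eq_bigr => k _; rewrite /zt.
  by case: asboolP => // /(_ (mesh_diag h k)).
have intlap : \int[lebesgue_measure]_(s in `[0, t]) diag_sum h N (lap s) =
    diag_sum h N (fun x => \int[lebesgue_measure]_(s in `[0, t]) lap s x).
  by apply: (Rintegral_diag_sum (m := lebesgue_measure) _ _).2 => // k.
have iz : lebesgue_measure.-integrable `[0, t]
    (EFin \o (fun s => diag_sum h N (z s))).
  apply: (Rintegral_diag_sum (m := lebesgue_measure) _ _).1 => // k.
  apply: continuous_compact_integrable; first exact: segment_compact.
  by apply: continuous_subspaceW (cz _ (mesh_diag h k)) => s /cut.
rewrite -mulNr -RintegralZl//.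
under [X in _ + X + _]eq_Rintegral do rewrite -sumlap.
rewrite intlap /diag_sum -!mulrDr -!big_split/=; congr (_ * _).
by apply: eq_bigr => k _; rewrite eqz intE -!mulrDr.
Qed.

End DiagSum.

(** * The mean of a solution *)

Section Solution.
Context d (Omega : measurableType d) (R : realType) (P : probability Omega R).
Local Notation mu := (@lebesgue_measure R).

Lemma ae_eq_integrable_Rintegral (f g : Omega -> R) :
  measurable_fun setT f -> P.-integrable setT (EFin \o g) ->
  {ae P, forall w, f w = g w} ->
  P.-integrable setT (EFin \o f) /\ \int[P]_w f w = \int[P]_w g w.
Proof.
move=> mf ig fg; have mg := measurable_int P ig.
have mf' : measurable_fun setT (EFin \o f) by exact/measurable_EFinP.
split; last first.
  congr fine; apply: ae_eq_integral => //.
  by apply: filterS fg => w /= -> _.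
apply/integrableP; split => //.
have /integrableP[_] := ig; apply: le_lt_trans.
rewrite le_eqVlt; apply/orP; left; apply/eqP; apply: ae_eq_integral => //.
- exact: measurableT_comp.
- exact: measurableT_comp.
- by apply: filterS fg => w /= -> _.
Qed.

Lemma measurable_diag_sum d' (U : measurableType d') (D : set U) (h : R)
    (N : nat) (g : U -> 'rV[R]_2 -> R) :
  (forall k : 'I_N, measurable_fun D (fun p => g p (mesh_point h k.+1 k.+1))) ->
  measurable_fun D (fun p => diag_sum h N (g p)).
Proof.
move=> mg; apply: measurable_funM => //; apply: measurable_sum => k.
by apply: measurable_funM => //; exact: mg.
Qed.

Lemma measurable_mesh_integral d' (U : measurableType d') (D : set U) (h : R)
    (N : nat) (g : U -> 'rV[R]_2 -> R) : h != 0 ->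
  (forall x, mesh N h x -> measurable_fun D (g^~ x)) ->
  measurable_fun D (fun p => mesh_integral h (mesh N h) (fun x => g p x ^+ 2)).
Proof.
move=> h0 mg.
under eq_fun do rewrite mesh_integralE//.
apply: measurable_funM => //; apply: measurable_sum => i.
apply: measurable_sum => j; apply: measurable_funX; apply: mg.
by exists i.+1, j.+1; rewrite !ltn_ord.
Qed.

Lemma L2_adapted_diag_sum (F : R -> set (set Omega)) (T h : R) (N : nat)
    (y : R -> Omega -> 'rV[R]_2 -> R) : h != 0 ->
  L2_adapted P F T h (mesh N h) y ->
  measurable_fun (slab T) (fun p => diag_sum h N (y p.1 p.2)) /\
  (mu \x P)%E.-integrable setT
    (slab_restrict T (fun s w => diag_sum h N (y s w))).
Proof.
move=> h0 [my _ yoo].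
have my' x : mesh N h x -> measurable_fun (slab T) (fun p => y p.1 p.2 x).
  exact: my.
have mZ : measurable_fun (slab T) (fun p => diag_sum h N (y p.1 p.2)).
  by apply: measurable_diag_sum => k; apply: my'; exact: mesh_diag.
split => //.
pose q s w := mesh_integral h (mesh N h) (fun x => y s w x ^+ 2).
pose K (s : R) (w : Omega) := h ^+ 2 * N%:R.
have iq : (mu \x P)%E.-integrable setT (slab_restrict T q).
  apply: ge0_integrable_slab => // [|s w]; last exact: mesh_integral_sqr_ge0.
  exact: measurable_mesh_integral.
have iK : (mu \x P)%E.-integrable setT (slab_restrict T K).
  apply: ge0_integrable_slab => // [s w|]; first by rewrite mulr_ge0 ?sqr_ge0.
  have Koo w : (\int[mu]_(s in `[0%R, T]) (K s w)%:E =
      (h ^+ 2 * N%:R)%:E * mu `[0%R, T])%E by rewrite /K integral_cst.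
  under eq_integral do rewrite Koo.
  rewrite integral_cst// [X in (_ * X)%E]probability_setT mule1.
  rewrite lebesgue_measure_itv/=; case: ifP => _; last by rewrite mule0 ltry.
  by rewrite -EFinB -EFinM ltry.
have mZT : measurable_fun setT (slab_restrict T (fun s w => diag_sum h N (y s w))).
  exact: measurable_slab_restrict.
apply: (le_integrable measurableT mZT _ (integrableD measurableT iK iq)) => p _.
rewrite /= /slab_restrict !patchE; case: ifPn => _; last by rewrite adde0.
by rewrite -EFinD /= lee_fin (le_trans (le_normr_diag_sum _ _ h0))// ler_norm.
Qed.

Lemma L2_initial_diag_sum (F : R -> set (set Omega)) (h : R) (N : nat)
    (y0 : Omega -> 'rV[R]_2 -> R) : h != 0 ->
  (forall x, mesh N h x -> measurable_fun setT (y0^~ x)) ->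
  L2_initial P F h (mesh N h) y0 ->
  P.-integrable setT (EFin \o (fun w => diag_sum h N (y0 w))).
Proof.
move=> h0 my0 [_ y0oo].
pose q w := mesh_integral h (mesh N h) (fun x => y0 w x ^+ 2).
have mq : measurable_fun setT q by exact: measurable_mesh_integral.
have iq : P.-integrable setT (EFin \o q).
  apply/integrableP; split; first exact/measurable_EFinP.
  apply: le_lt_trans y0oo; rewrite le_eqVlt; apply/orP; left; apply/eqP.
  by apply: eq_integral => w _ /=; rewrite ger0_norm// mesh_integral_sqr_ge0.
have iK : P.-integrable setT (EFin \o cst (h ^+ 2 * N%:R)).
  exact: finite_measure_integrable_cst.
apply: (le_integrable measurableT _ _ (integrableD measurableT iK iq)).
  apply/measurable_EFinP; apply: measurable_diag_sum => k.
  apply: my0; exact: mesh_diag.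
move=> w _; rewrite /= lee_fin (le_trans (le_normr_diag_sum _ _ h0))//.
exact: ler_norm.
Qed.

(** The control u drops out because no diagonal point is in G0, and the
control v because stochastic integrals have mean zero. *)
Lemma mean_diag_sum_decay (B : R -> Omega -> R) (T h : R) (N : nat)
    (G0 : set 'rV[R]_2) (u v y : R -> Omega -> 'rV[R]_2 -> R)
    (y0 : Omega -> 'rV[R]_2 -> R) :
  measure_is_complete P -> standard_brownian_motion P B ->
  0 < T -> h != 0 ->
  (forall i j : nat, (G0 `&` mesh N h) (mesh_point h i j) -> i <> j) ->
  L2_initial P (augmented_filtration P B) h (mesh N h) y0 ->
  is_solution P B (augmented_filtration P B) T N h G0 u v y0 y ->
  [/\ P.-integrable setT (EFin \o (fun w => diag_sum h N (y0 w))),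
      P.-integrable setT (EFin \o (fun w => diag_sum h N (y T w)))
    & \int[P]_w diag_sum h N (y T w) =
      expR (- (4 / h ^+ 2 * T)) * \int[P]_w diag_sum h N (y0 w)].
Proof.
set F := augmented_filtration P B.
move=> cP hB T0 h0 hdiag hy0 [yL2 ycont yeq ybd yini].
have mF t (f : Omega -> R) : measurable_wrt (F t) f -> measurable_fun setT f.
  exact: (measurable_wrt_augmented (bm_measurable hB) cP).
have iy0 : P.-integrable setT (EFin \o (fun w => diag_sum h N (y0 w))).
  apply: (L2_initial_diag_sum h0 _ hy0) => x mx.
  by apply: mF; exact: hy0.1.
have [_ ya _] := yL2.
pose Z t w := diag_sum h N (y t w).
have mZ t : 0 <= t <= T -> measurable_fun setT (Z t).
  move=> tT; apply: measurable_diag_sum => k; apply: (mF t).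
  by apply: ya => //; exact: mesh_diag.
have [mZT iZT] := L2_adapted_diag_sum h0 yL2.
have [iZ0 EZ0] : P.-integrable setT (EFin \o Z 0) /\
    \int[P]_w Z 0 w = \int[P]_w diag_sum h N (y0 w).
  apply: ae_eq_integrable_Rintegral => //; first by apply: mZ; rewrite lexx ltW.
  apply: filterS yini => w yw; rewrite /Z /diag_sum; congr (_ * _).
  by apply: eq_bigr => k _; rewrite yw//; exact: mesh_diag.
pose c := 4 / h ^+ 2.
pose J t w := \int[mu]_(s in `[0, t]) Z s w.
have step t : 0 <= t <= T -> P.-integrable setT (EFin \o Z t) /\
    \int[P]_w Z t w = \int[P]_w Z 0 w - c * \int[P]_w J t w.
  move=> tT.
  have /choice[I HI] : forall x, exists I : Omega -> R, mesh N h x ->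
      is_ito_integral P B F (fun s w => v s w x) t I /\
      {ae P, forall w, y t w x = y 0 w x
        + \int[mu]_(s in `[0, t])
            (\sum_(i < 2) D2 h i (y s w) x
             + \1_(G0 `&` mesh N h) x * u s w x)
        + I w}.
    move=> x; have [mx|nx] := pselect (mesh N h x); last by exists (cst 0).
    by have [I HI] := yeq t x tT mx; exists I.
  pose M w := diag_sum h N (fun x => I x w).
  have [iM EM] : P.-integrable setT (EFin \o M) /\ \int[P]_w M w = 0.
    have I0 (k : 'I_N) := ito_integral_mean_zero cP hB (HI _ (mesh_diag h k)).1.
    have [iM ->] := Rintegral_diag_sum (m := P) (g := fun w x => I x w) (h := h)
      measurableT (fun k => (I0 k).1).
    split => //; rewrite /diag_sum big1 ?mulr0// => k _.
    by rewrite (I0 k).2 mulr0.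
  have [iJ EJ] := integral_mean mZT iZT (andP tT).2.
  have icJ : P.-integrable setT (EFin \o (fun w => c * J t w)).
    exact: (integrableZl measurableT c iJ).
  have iB : P.-integrable setT (EFin \o (fun w => Z 0 w - c * J t w)).
    exact: (integrableB measurableT iZ0 icJ).
  have iS : P.-integrable setT (EFin \o (fun w => Z 0 w - c * J t w + M w)).
    exact: (integrableD measurableT iB iM).
  have [iZt ->] : P.-integrable setT (EFin \o Z t) /\
      \int[P]_w Z t w = \int[P]_w (Z 0 w - c * J t w + M w).
    apply: ae_eq_integrable_Rintegral => //; first exact: mZ.
    have eqk : {ae P, forall w, forall k, (k < N)%N ->
        let x := mesh_point h k.+1 k.+1 in
        y t w x = y 0 w x +
          \int[mu]_(s in `[0, t]) (\sum_(i < 2) D2 h i (y s w) x) + I x w}.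
      apply: ae_foralln => k; have [kN|] := ltnP k N; last by move=> _; exact: aeW.
      apply: filterS (HI _ (mesh_diag h (Ordinal kN))).2 => w /= -> _.
      congr (_ + _ + _); apply: eq_Rintegral => s _.
      rewrite indicE memNset ?mul0r ?addr0// => Gk.
      exact: hdiag Gk _.
    apply: filterS3 ycont ybd eqk => w cw bw ew.
    apply: (diag_sum_pathwise h0 tT) => //.
    by move=> k; exact: ew.
  split => //.
  rewrite RintegralD// EM addr0 RintegralB//; congr (_ - _).
  exact: RintegralZl.
pose m t := \int[P]_w Z t w.
have mE t : 0 <= t <= T -> ((m t)%:E = \int[P]_w (Z t w)%:E)%E.
  move=> /step[iZt _]; rewrite fineK//.
  exact: integrable_fin_num (iZt).
have TT : 0 <= T <= T by rewrite lexx ltW.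
split => //; first exact: (step T TT).1.
rewrite -EZ0; apply: (exponential_decay (m := m)) => //.
  apply: eq_integrable (integrable_mean iZT) => //= s.
  by rewrite inE/= in_itv/= => sT; rewrite mE.
move=> t tT; have [_ Et] := step t tT; rewrite {1}/m Et; congr (_ - _ * _).
have [_ EJ] := integral_mean mZT iZT (andP tT).2.
rewrite [LHS]/Rintegral EJ; congr fine; apply: eq_integral => s.
rewrite inE/= in_itv/= => /andP[s0 st].
by rewrite mE// s0 (le_trans st)//; case/andP: tT.
Qed.

End Solution.

(** * The theorem *)

Theorem mainTheorem5 (R : realType) (d : measure_display)
  (Omega : measurableType d) (P : probability Omega R)
  (hP : measure_is_complete P)
  (B : R -> Omega -> R) (hB : standard_brownian_motion P B)
  (F : R -> set (set Omega)) (hF : F = augmented_filtration P B)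
  (T : R) (hT : 0 < T) (N : nat) (h : R) (hh : h = 1 / N.+1%:R)
  (G0 : set 'rV[R]_2) (hG0 : G0 `<=` @unit_square R)
  (hdiag : forall i j : nat, (G0 `&` mesh N h) (mesh_point h i j) -> i <> j)
  (psi : 'rV[R]_2 -> R)
  (hpsi : forall i j : nat, (1 <= i <= N)%N -> (1 <= j <= N)%N ->
    psi (mesh_point h i j) = if i == j then (-1) ^+ i else 0)
  (y0 : Omega -> 'rV[R]_2 -> R) (hy0 : L2_initial P F h (mesh N h) y0) :
  let controls (u v : R -> Omega -> 'rV[R]_2 -> R) :=
    L2_adapted P F T h (G0 `&` mesh N h) u /\
    L2_adapted P F T h (mesh N h) v in
  let psi_mean (z : Omega -> 'rV[R]_2 -> R) : \bar R :=
    ('E_P[fun w => mesh_integral h (mesh N h) (fun x => (psi x * z w x)%R)])%E in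
  [/\ forall u v y, controls u v -> is_solution P B F T N h G0 u v y0 y ->
        psi_mean (y T) = ((expR (- (4 * T / h ^+ 2)))%:E * psi_mean y0)%E,
      forall u v y u' v' y',
        controls u v -> is_solution P B F T N h G0 u v y0 y ->
        controls u' v' -> is_solution P B F T N h G0 u' v' y0 y' ->
        psi_mean (y T) = psi_mean (y' T),
      psi_mean y0 <> 0%E ->
        forall u v y, controls u v -> is_solution P B F T N h G0 u v y0 y ->
        psi_mean (y T) <> 0%E
    & psi_mean y0 <> 0%E ->
        ~ exists u v y, [/\ controls u v,
            is_solution P B F T N h G0 u v y0 y
          & {ae P, forall w, forall x, mesh N h x -> y T w x = 0}]].

Proof.
move=> controls psi_mean.
have h0 : h != 0 by rewrite hh mul1r invr_eq0 pnatr_eq0.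
have meanE z : psi_mean z = (\int[P]_w (diag_sum h N (z w))%:E)%E.
  rewrite /psi_mean unlock; apply: eq_integral => w _.
  by rewrite (mesh_integral_diag _ h0 hpsi).
have decay u v y : controls u v -> is_solution P B F T N h G0 u v y0 y ->
    psi_mean (y T) = ((expR (- (4 * T / h ^+ 2)))%:E * psi_mean y0)%E.
  move=> _ sol; rewrite hF in hy0 sol.
  have [iy0 iyT E] := mean_diag_sum_decay hP hB hT h0 hdiag hy0 sol.
  rewrite !meanE -(fineK (integrable_fin_num measurableT iyT)).
  rewrite -(fineK (integrable_fin_num measurableT iy0)) -EFinM mulrAC.
  by congr EFin.
have nonzero u v y : psi_mean y0 <> 0%E -> controls u v ->
    is_solution P B F T N h G0 u v y0 y -> psi_mean (y T) <> 0%E.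
  move=> /eqP y00 uv sol; rewrite (decay _ _ _ uv sol); apply/eqP.
  by rewrite mule_eq0 negb_or y00 andbT eqe expR_eq0.
split => //.
- move=> u v y u' v' y' uv sol uv' sol'.
  by rewrite (decay _ _ _ uv sol) (decay _ _ _ uv' sol').
- by move=> y00 u v y; exact: nonzero.
- move=> y00 [u [v [y [uv sol yT0]]]]; apply: (nonzero _ _ _ y00 uv sol).
  have sol' := sol; rewrite hF in hy0 sol'.
  have [_ iyT _] := mean_diag_sum_decay hP hB hT h0 hdiag hy0 sol'.
  rewrite meanE -[RHS](integral0 P setT); apply: ae_eq_integral => //.
    exact: measurable_int iyT.
  apply: filterS yT0 => w yT0 _; congr EFin; rewrite /diag_sum.
  by rewrite big1 ?mulr0// => k _; rewrite yT0 ?mulr0//; exact: mesh_diag.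
Qed.
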